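(* Let $\Bbbk$ be a field, let $\Delta$ be a pure simplicial complex on $[n]=\{1,\dots,n\}$, and let $r\ge 2$. Then the maximal length of the $j$-th linear part of the minimal graded free resolution of $\Bbbk[\Delta]$ for $j<r$ is less than or equal to $n-S_r\text{-}\mathrm{depth}(\Bbbk[\Delta])$, that is, $$\max\{i : \beta_{i,i+j}(\Bbbk[\Delta])\neq 0 \text{ for some } j<r\}\le n-S_r\text{-}\mathrm{depth}(\Bbbk[\Delta]).$$
   Context: Let $S=\Bbbk[x_1,\dots,x_n]$ with the standard grading, $\mathfrak m=(x_1,\dots,x_n)$, $\omega_S$ the canonical module. For an unmixed finitely generated graded $S$-module $M$ and $r\ge 2$, the Serre depth for $(S_r)$ is $S_r\text{-}\mathrm{depth}(M)=\min\{j : \dim K_M^j\ge j-r+1\}$, where $K_M^j=\mathrm{Hom}_{\Bbbk}(H^j_{\mathfrak m}(M),\Bbbk)\cong \mathrm{Ext}_S^{n-j}(M,\omega_S)$, $\dim$ is Krull dimension, and $\dim 0=-\infty$. A simplicial complex $\Delta$ on $[n]$ is a nonempty collection of subsets of $[n]$ closed under taking subsets (it is not assumed that every $\{i\}$ is in $\Delta$); it is pure if all facets have the same cardinality. $I_\Delta\subset S$ is the ideal generated by the squarefree monomials corresponding to (minimal) non-faces of $\Delta$, and $\Bbbk[\Delta]=S/I_\Delta$. $\beta_{i,j}(M)$ denotes the $(i,j)$-th graded Betti number of $M$ over $S$. *)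

(* Defs.v *)
From HB Require Import structures.
From mathcomp Require Import all_boot all_order all_algebra.
From mathcomp Require Import boolp.
From mathcomp Require Import mpoly.

Set Implicit Arguments.
Unset Strict Implicit.
Unset Printing Implicit Defensive.

Import Order.TTheory GRing.Theory Num.Theory.

Local Open Scope ring_scope.
Local Open Scope quotient_scope.

(* [Delta] is nonempty, so it contains [set0]; singletons need not be faces. *)
Definition simplicial_complex (n : nat) (Delta : {set {set 'I_n}}) : Prop :=
  Delta != set0 /\
  (forall A B : {set 'I_n}, B \in Delta -> A \subset B -> A \in Delta).

Definition facet (n : nat) (Delta : {set {set 'I_n}}) (A : {set 'I_n}) : bool :=
  maxset (fun B : {set 'I_n} => B \in Delta) A.

Definition pure (n : nat) (Delta : {set {set 'I_n}}) : Prop :=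
  forall A B : {set 'I_n}, facet Delta A -> facet Delta B -> #|A| = #|B|.

Section StanleyReisner.

Variables (k : fieldType) (n : nat) (Delta : {set {set 'I_n}}).

Definition SR_ideal : {pred {mpoly k[n]}} := fun p =>
  `[< exists c : {set 'I_n} -> {mpoly k[n]},
        p = \sum_(A : {set 'I_n} | A \notin Delta) c A * \prod_(i in A) 'X_i >].

Lemma SR_idealMD (a p q : {mpoly k[n]}) :
  p \in SR_ideal -> q \in SR_ideal -> a * p + q \in SR_ideal.
Proof.
move=> /asboolP[c ->] /asboolP[d ->]; apply/asboolP.
exists (fun A => a * c A + d A); rewrite mulr_sumr -big_split /=.
by apply: eq_bigr => A _; rewrite mulrA mulrDl.
Qed.

Lemma SR_ideal0 : 0 \in SR_ideal.
Proof.
by apply/asboolP; exists (fun=> 0); rewrite big1 // => A _; rewrite mul0r.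
Qed.

Lemma SR_ideal_zmod_closed : zmod_closed SR_ideal.
Proof.
split; first exact: SR_ideal0.
by move=> p q Ip Iq; rewrite -mulN1r addrC SR_idealMD.
Qed.

HB.instance Definition _ :=
  GRing.isZmodClosed.Build {mpoly k[n]} SR_ideal SR_ideal_zmod_closed.

Definition SR_ring : Type := Quotient.quot SR_ideal.

HB.instance Definition _ := GRing.Zmodule.on SR_ring.

Definition SR_pi (p : {mpoly k[n]}) : SR_ring := \pi_(Quotient.quot SR_ideal) p.

Definition SR_scale (a : {mpoly k[n]}) (x : SR_ring) : SR_ring :=
  SR_pi (a * repr (x : Quotient.quot SR_ideal)).

Lemma SR_piP (p q : {mpoly k[n]}) :
  (SR_pi p == SR_pi q) = (p - q \in SR_ideal).
Proof. by rewrite Quotient.idealrBE. Qed.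

Lemma SR_piD : {morph SR_pi : p q / p + q}.
Proof. by move=> p q; rewrite /SR_pi !piE. Qed.

Lemma SR_scale_pi (a p : {mpoly k[n]}) : SR_scale a (SR_pi p) = SR_pi (a * p).
Proof.
apply/eqP; rewrite SR_piP -mulrBr -[_ * _]addr0 SR_idealMD ?SR_ideal0 //.
by rewrite -SR_piP /SR_pi reprK.
Qed.

Lemma SR_pi_surj (x : SR_ring) : exists p, x = SR_pi p.
Proof. by exists (repr (x : Quotient.quot SR_ideal)); rewrite /SR_pi reprK. Qed.

Lemma SR_scaleA (a b : {mpoly k[n]}) (x : SR_ring) :
  SR_scale a (SR_scale b x) = SR_scale (a * b) x.
Proof. by have [p ->] := SR_pi_surj x; rewrite !SR_scale_pi mulrA. Qed.

Lemma SR_scale1 : left_id 1 SR_scale.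
Proof. by move=> x; have [p ->] := SR_pi_surj x; rewrite SR_scale_pi mul1r. Qed.

Lemma SR_scaleDr : right_distributive SR_scale +%R.
Proof.
move=> a x y; have [p ->] := SR_pi_surj x; have [q ->] := SR_pi_surj y.
by rewrite -SR_piD !SR_scale_pi -SR_piD mulrDr.
Qed.

Lemma SR_scaleDl (x : SR_ring) : {morph SR_scale^~ x : a b / a + b}.
Proof.
by move=> a b; have [p ->] := SR_pi_surj x; rewrite !SR_scale_pi -SR_piD mulrDl.
Qed.

HB.instance Definition _ := GRing.Zmodule_isLmodule.Build {mpoly k[n]} SR_ring
  SR_scaleA SR_scale1 SR_scaleDr SR_scaleDl.

End StanleyReisner.

(* Homogeneous elements of S of integer degree [d]: only 0 when [d < 0]. *)
Definition homog_deg (k : fieldType) (n : nat) (d : int) (p : {mpoly k[n]}) :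
  Prop :=
  match d with
  | Posz e => p \is e.-homog
  | Negz _ => p = 0
  end.

Definition SR_graded (k : fieldType) (n : nat) (Delta : {set {set 'I_n}})
    (d : int) (x : SR_ring k Delta) : Prop :=
  exists2 p : {mpoly k[n]}, homog_deg d p & x = SR_pi Delta p.

(* A resolution of the graded S-module [M] (with graded pieces [gr d]) by
   finitely generated graded free modules
     F_i = \bigoplus_(a < frank i) S(- fdeg a) = 'rV[S]_(frank i).
   Maps act on row vectors on the right: F_(i+1) -> F_i is v |-> v *m fdiff i. *)
Record graded_free_resolution (k : fieldType) (n : nat)
    (M : lmodType {mpoly k[n]}) (gr : int -> M -> Prop) := GradedFreeResolution {
  frank : nat -> nat;
  fdeg : forall i : nat, 'I_(frank i) -> int;
  fdiff : forall i : nat, 'M[{mpoly k[n]}]_(frank i.+1, frank i);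
  faug : {linear 'rV[{mpoly k[n]}]_(frank 0) -> M};
  fdiff_homog : forall (i : nat) (a : 'I_(frank i.+1)) (b : 'I_(frank i)),
    homog_deg (fdeg a - fdeg b) (fdiff i a b);
  faug_homog : forall a : 'I_(frank 0), gr (fdeg a) (faug (delta_mx 0 a));
  faug_surj : forall x : M, exists v, faug v = x;
  faug_exact : forall v : 'rV_(frank 0),
    faug v = 0 <-> exists w, v = w *m fdiff 0;
  fdiff_exact : forall (i : nat) (v : 'rV_(frank i.+1)),
    v *m fdiff i = 0 <-> exists w, v = w *m fdiff i.+1
}.

Section Invariants.

Variables (k : fieldType) (n : nat).
Variables (M : lmodType {mpoly k[n]}) (gr : int -> M -> Prop).
Variable F : graded_free_resolution gr.

(* F_(i+1) -> F_i has image in (x_1, ..., x_n) F_i: the entries of its matrix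
   have no constant term. *)
Definition minimal_resolution : Prop :=
  forall (i : nat) (a : 'I_(frank F i.+1)) (b : 'I_(frank F i)),
    (fdiff F i a b)@_0%MM = 0.

(* The graded Betti number beta_{i,j}(M), when [F] is minimal. *)
Definition betti (i : nat) (j : int) : nat :=
  #|[set a : 'I_(frank F i) | fdeg a == j]|.

(* Ext^i_S(M, omega_S) is cocycles modulo coboundaries in Hom_S(F, omega_S).
   As omega_S = S(-n) is S up to a shift of the grading, Hom_S(F_i, omega_S) is,
   as an ungraded module, the module of column vectors of size [frank F i]; the
   coboundary map is the left multiplication by [fdiff F i]. *)
Definition ext_cocycle (i : nat) (w : 'cV[{mpoly k[n]}]_(frank F i)) : Prop :=
  fdiff F i *m w = 0.

Definition ext_coboundary (i : nat) :
    'cV[{mpoly k[n]}]_(frank F i) -> Prop :=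
  match i with
  | 0 => fun w => w = 0
  | i'.+1 => fun w => exists u : 'cV_(frank F i'), w = fdiff F i' *m u
  end.

End Invariants.

Section KrullDimension.

Variables (R : comNzRingType) (V : lmodType R) (Z B : V -> Prop).

Definition subquo_ann (f : R) : Prop := forall z : V, Z z -> B (f *: z).

(* P 0 < P 1 < ... < P l are prime ideals containing the annihilator of Z/B. *)
Definition ann_prime_chain (l : nat) (P : nat -> {pred R}) : Prop :=
  (forall i : nat, (i <= l)%N ->
     [/\ idealr_closed (P i), prime_idealr_closed (P i) &
         forall f : R, subquo_ann f -> f \in P i]) /\
  (forall i : nat, (i < l)%N ->
     {subset P i <= P i.+1} /\ exists2 f : R, f \in P i.+1 & f \notin P i).

(* dim (Z/B) >= c, where dim (Z/B) is the supremum in {-oo, 0, 1, ..., +oo} of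
   the lengths of these chains; it fails for every [c] when Z/B = 0, which is
   the convention dim 0 = -oo. *)
Definition krull_dim_ge (c : int) : Prop :=
  exists l : nat, c <= l%:Z /\ exists P : nat -> {pred R}, ann_prime_chain l P.

End KrullDimension.

Definition is_min (P : nat -> Prop) (m : nat) : Prop :=
  P m /\ forall j : nat, P j -> (m <= j)%N.

Definition is_max (P : nat -> Prop) (m : nat) : Prop :=
  P m /\ forall j : nat, P j -> (j <= m)%N.

Section SerreDepth.

Variables (k : fieldType) (n : nat).
Variables (M : lmodType {mpoly k[n]}) (gr : int -> M -> Prop).
Variable F : graded_free_resolution gr.

(* dim K_M^j >= c, where K_M^j = Ext^(n-j)_S(M, omega_S); K_M^j = 0 for j > n. *)
Definition dim_K_ge (j : nat) (c : int) : Prop :=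
  (j <= n)%N /\
  krull_dim_ge (@ext_cocycle k n M gr F (n - j))
               (@ext_coboundary k n M gr F (n - j)) c.

Definition is_serre_depth (r s : nat) : Prop :=
  is_min (fun j : nat => dim_K_ge j (j%:Z - r%:Z + 1)) s.

(* [m] is max {i : beta_{i,i+j}(M) != 0 for some j < r}, when [F] is minimal. *)
Definition is_linear_length (r m : nat) : Prop :=
  is_max (fun i : nat =>
    exists j : int, j < r%:Z /\ betti F i (i%:Z + j) <> 0%N) m.

End SerreDepth.

(* Main.v *)
(* Let T be the "ordered Taylor resolution" of k[Delta]: a basis of T_i is given
   by the i-tuples s of nonfaces, placed in the multidegree [cover s] (the union
   of s), and the differential drops one entry at a time.  For U <= W, the
   tuples s with U <= cover s <= W span a cochain complex C(W, U) over k.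

   If beta_(i,i+j) <> 0, comparing the given minimal resolution with T yields a
   nonzero class in H^i(C(W, W)) for some W of cardinality i + j.  For v not in
   W, the long exact sequence relating C(v+W, v+U), C(v+W, U) and C(W, U) shows
   that a nonzero class in H^p(C(W, U)) gives one in H^p(C(v+W, U)) or in
   H^(p+1)(C(v+W, v+U)).  Iterating, H^p(C([n], U)) <> 0 for some U containing
   W, with p = #|U| - j.  Such a class gives an element of Ext^p(k[Delta], S)
   whose annihilator lies in the prime generated by the x_u, u in U.  With
   l = n - p this means dim K^l >= n - #|U| = l - j >= l - r + 1, and
   l = n - #|U| + j <= n - i. *)
Require Import Defs.
From HB Require Import structures.
From mathcomp Require Import all_boot all_order all_algebra.
From mathcomp Require Import boolp.
From mathcomp Require Import ssrcomplements mpoly zify.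

Set Implicit Arguments.
Unset Strict Implicit.
Unset Printing Implicit Defensive.

Import Order.TTheory GRing.Theory Num.Theory.

Local Open Scope ring_scope.

(** * Alternating sums over subtuples *)

(** The simplicial coboundary: the entry at position i of [s] is dropped with sign (-1)^i. Recursion
    on the head keeps the signs free of indices. *)
Fixpoint altsum (N : Type) (L : zmodType) (s : seq N) (z : seq N -> L) : L :=
  if s is A :: s' then z s' - altsum s' (fun t => z (A :: t)) else 0.

Section AltSum.

Variable N : eqType.
Implicit Types (s t : seq N) (A : N).

Lemma eq_altsum (L : zmodType) s (z z' : seq N -> L) :
    (forall t, size s = (size t).+1 -> subseq t s -> z t = z' t) ->
  altsum s z = altsum s z'.
Proof.
elim: s z z' => //= A s IHs z z' zz'; congr (_ - _).
  by apply: zz' => //; apply: subseq_cons.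
apply: IHs => t st ts; apply: zz'; first by rewrite /= st.
by rewrite /= eqxx.
Qed.

Lemma altsum_morph (L L' : zmodType) (f : L -> L') s (z : seq N -> L) :
  {morph f : x y / x - y} -> f (altsum s z) = altsum s (fun t => f (z t)).
Proof.
move=> fB; have f0 : f 0 = 0 by rewrite -(subrr 0) fB subrr.
by elim: s z => //= A s IHs z; rewrite fB IHs.
Qed.

Lemma altsum0 (L : zmodType) s : altsum s (fun=> 0 : L) = 0.
Proof. by elim: s => //= A s ->; rewrite subrr. Qed.

Lemma altsum_eq0 (L : zmodType) s (z : seq N -> L) :
    (forall t, size s = (size t).+1 -> subseq t s -> z t = 0) ->
  altsum s z = 0.
Proof. by move=> z0; rewrite (eq_altsum z0) altsum0. Qed.

Lemma altsumB (L : zmodType) s (z z' : seq N -> L) :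
  altsum s (fun t => z t - z' t) = altsum s z - altsum s z'.
Proof.
elim: s z z' => [|A s IHs] z z' /=; first by rewrite subrr.
by rewrite IHs !opprB addrACA [RHS]addrACA [- z' s + _]addrC.
Qed.

Lemma altsum_sum (L : zmodType) (I : Type) (r : seq I) (P : pred I) s
    (z : I -> seq N -> L) :
  \sum_(i <- r | P i) altsum s (z i) =
  altsum s (fun t => \sum_(i <- r | P i) z i t).
Proof.
elim: s z => [|A s IHs] z /=; first by rewrite big1.
by rewrite sumrB IHs.
Qed.

(** The coboundary squares to zero: dropping the head first and dropping it second give the same sum
    with opposite signs, and what remains is the induction hypothesis for the tail. *)
Lemma altsum_altsum (L : zmodType) s (z : seq N -> L) :
  altsum s (fun t => altsum t z) = 0.
Proof.
elim: s z => //= A s IHs z.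
by rewrite altsumB IHs subr0 subrr.
Qed.

End AltSum.

(** * Cohomology of the complexes C(W, U) *)

Section Cohomology.

Variables (k : fieldType) (N : eqType) (n : nat) (lab : N -> {set 'I_n}).
Implicit Types (s t : seq N) (U W : {set 'I_n}) (z y : seq N -> k).

Definition cover_seq s : {set 'I_n} := \bigcup_(A <- s) lab A.

Lemma cover_seq_cons A s : cover_seq (A :: s) = lab A :|: cover_seq s.
Proof. by rewrite /cover_seq big_cons. Qed.

Lemma cover_seqS s t : subseq t s -> cover_seq t \subset cover_seq s.
Proof.
elim: s t => [|A s IHs] [|B t] //=; first by rewrite /cover_seq big_nil sub0set.
case: eqP => [->|_] ts; rewrite [cover_seq (A :: s)]cover_seq_cons.
  by rewrite cover_seq_cons setUS ?IHs.
by rewrite (subset_trans (IHs _ ts)) ?subsetUr.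
Qed.

(** Cochains are functions on all sequences. The lower bound [U] on covers is imposed by cutting off
    values, the upper bound [W] by restricting the sequences at which conditions are tested; this
    suffices because covers shrink under deletion. *)
Definition above U z : seq N -> k :=
  fun t => if U \subset cover_seq t then z t else 0.

Definition cocycle W U (p : nat) z : Prop :=
  forall s, size s = p.+1 -> cover_seq s \subset W -> altsum s (above U z) = 0.

Definition coboundary W U (p : nat) z : Prop :=
  exists y, forall s, size s = p -> U \subset cover_seq s ->
    cover_seq s \subset W -> z s = altsum s (above U y).

Definition has_cohomology W U (p : nat) : Prop :=
  exists2 z, cocycle W U p z & ~ coboundary W U p z.

Lemma altsum_above_eq0 U z s :
  ~~ (U \subset cover_seq s) -> altsum s (above U z) = 0.
Proof.
move=> Us; apply: altsum_eq0 => t _ ts; rewrite /above ifN //.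
by apply: contra Us => /subset_trans; apply; apply: cover_seqS.
Qed.

(* The long exact sequence of the pair formed by the tuples covering [v] and
   all tuples. *)
Lemma has_cohomology_step W U p v :
    has_cohomology W U p -> v \notin W ->
  has_cohomology (v |: W) U p \/ has_cohomology (v |: W) (v |: U) p.+1.
Proof.
move=> [z zcoc zncob] vW.
(* [z'] extends [z] by zero to C(v+W, U). Its coboundary represents the image of the class under the
   connecting homomorphism: it vanishes on tuples missing [v], since these lie in [W], where [z] is
   a cocycle. *)
pose z' t := if cover_seq t \subset W then above U z t else 0.
have z'U t : ~~ (U \subset cover_seq t) -> z' t = 0.
  by move=> /negbTE Ut; rewrite /z' /above Ut if_same.
have dz'0 t : size t = p.+1 -> cover_seq t \subset v |: W ->
    ~~ (v |: U \subset cover_seq t) -> altsum t z' = 0.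
  move=> st tW; rewrite subUset sub1set negb_and => /orP[vt|Ut]; last first.
    apply: altsum_eq0 => u _ ut; apply/z'U; apply: contra Ut.
    by move=> /subset_trans; apply; apply: cover_seqS.
  have tW' : cover_seq t \subset W.
    apply/subsetP => x xt; have := subsetP tW _ xt; rewrite in_setU1.
    by case/orP=> // /eqP xv; rewrite -xv xt in vt.
  rewrite -(zcoc t st tW'); apply: eq_altsum => u _ /cover_seqS ut.
  by rewrite /z' (subset_trans ut tW').
have [|wncob] := EM (coboundary (v |: W) (v |: U) p.+1 (fun s => altsum s z'));
  last first.
  right; exists (fun s => altsum s z') => // s ss sW.
  rewrite -[RHS](altsum_altsum s z'); apply: eq_altsum => t.
  rewrite ss => -[st] ts; rewrite /above; case: ifPn => // vUt.
  by rewrite dz'0 // (subset_trans (cover_seqS ts) sW).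
(* If the connecting class is trivial, subtracting [y] turns [z'] into a cocycle without changing
   its values on tuples inside [W], which miss [v]; a primitive of the difference thus restricts to
   one of [z]. *)
case=> y dz'; left.
exists (fun t => z' t - above (v |: U) y t).
  move=> s ss sW.
  rewrite (@eq_altsum _ _ _ _ (fun t => z' t - above (v |: U) y t)); last first.
    move=> t _ ts; rewrite {1}/above; case: ifPn => // Ut.
    rewrite z'U // /above ifN ?subrr //.
    by apply: contra Ut => /(subset_trans (subsetUr _ _)).
  rewrite altsumB; have [vUs|vUs] := boolP (v |: U \subset cover_seq s).
    by rewrite dz' // subrr.
  by rewrite dz'0 // altsum_above_eq0 // subrr.
case=> x xP; apply: zncob; exists x => s ss Us sW.
rewrite -xP //; last by rewrite (subset_trans sW) ?subsetUr.
rewrite /z' sW /above Us ifN ?subr0 // subUset sub1set negb_and.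
by rewrite (contra _ vW) // => /(subsetP sW).
Qed.

(** The vertices outside [W] are adjoined one at a time. Each step either keeps both [U] and the
    degree or raises [#|U|] and the degree by one, so their difference is constant. *)
Lemma has_cohomology_setT W U p :
    has_cohomology W U p -> U \subset W ->
  exists U', [/\ U \subset U' & has_cohomology setT U' (p + (#|U'| - #|U|))].
Proof.
have [m] := ubnP #|~: W|.
elim: m W U p => // m IHm W U p Wm hW UW.
have [/eqP|] := boolP (W == setT).
  by move=> WT; exists U; rewrite subnn addn0 -WT.
rewrite -subTset => /subsetPn[v _ vW].
have vU : v \notin U by apply: contra vW; apply: (subsetP UW).
have Wm' : (#|~: (v |: W)| < m)%N.
  rewrite -ltnS (leq_trans _ Wm) // ltnS; apply: proper_card.
  rewrite setCU properE subsetIr /=; apply/subsetPn; exists v.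
    by rewrite inE.
  by rewrite !inE eqxx.
case: (has_cohomology_step hW vW) => /IHm -/(_ Wm').
  by apply; rewrite (subset_trans UW) ?subsetUr.
case; first exact: setUS.
move=> U' [vUU' hU']; exists U'; split.
  by rewrite (subset_trans _ vUU') ?subsetUr.
have := subset_leq_card vUU'; rewrite cardsU1 vU add1n => cU'.
by move: hU'; rewrite cardsU1 vU add1n addSnnS -subSn // subSS.
Qed.

End Cohomology.

(** * Comparison of graded free resolutions *)

Section Homogeneous.

Variables (k : fieldType) (n : nat).
Implicit Types (p q : {mpoly k[n]}) (d e : int) (m : 'X_{1..n}).

Lemma homog_degP d p :
  homog_deg d p <-> forall m, p@_m != 0 -> (mdeg m)%:Z = d.
Proof.
case: d => d /=; split.
- by move=> /dhomogP ph m; rewrite -mcoeff_msupp => /ph <-.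
- by move=> ph; apply/dhomogP => m; rewrite mcoeff_msupp => /ph [<-].
- by move=> -> m; rewrite mcoeff0 eqxx.
move=> ph; apply/mpolyP => m; rewrite mcoeff0.
by have [//|/ph] := eqVneq p@_m 0.
Qed.

Lemma homog_degM d e p q :
  homog_deg d p -> homog_deg e q -> homog_deg (d + e) (p * q).
Proof.
move=> /homog_degP ph /homog_degP qh; apply/homog_degP => m.
apply: contra_neq_eq; rewrite mcoeffM => md; rewrite big1 // => -[m1 m2] /= /eqP mE.
have [->|/ph m1d] := eqVneq p@_m1 0; first by rewrite mul0r.
have [->|/qh m2d] := eqVneq q@_m2 0; first by rewrite mulr0.
by case/eqP: md; rewrite mE mdegD PoszD m1d m2d.
Qed.

Lemma homog_deg_sum (I : Type) (r : seq I) (P : pred I) d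
    (f : I -> {mpoly k[n]}) :
  (forall i, P i -> homog_deg d (f i)) ->
  homog_deg d (\sum_(i <- r | P i) f i).
Proof.
move=> fh; elim/big_ind: _ => //.
  by apply/homog_degP => m; rewrite mcoeff0 eqxx.
move=> p q /homog_degP ph /homog_degP qh; apply/homog_degP => m.
rewrite mcoeffD; have [->|/ph //] := eqVneq p@_m 0; rewrite add0r; exact: qh.
Qed.

Definition homog_comp d p : {mpoly k[n]} :=
  \sum_(m <- msupp p | (mdeg m)%:Z == d) p@_m *: 'X_[m].

Lemma mcoeff_homog_comp d p m :
  (homog_comp d p)@_m = if (mdeg m)%:Z == d then p@_m else 0.
Proof.
rewrite raddf_sum /=.
under eq_bigr do rewrite mcoeffZ mcoeffX.
have [mp|mp] := boolP (m \in msupp p); last first.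
  have pm : p@_m = 0 by apply/eqP; rewrite mcoeff_eq0.
  rewrite pm if_same big_seq_cond big1 // => m' /andP[m'p _].
  by case: eqP => [m'm|_]; rewrite ?mulr0 // -m'm m'p in mp *.
rewrite big_mkcond (bigD1_seq m) //= eqxx mulr1 big1 ?addr0 // => m' /negPf ->.
by rewrite mulr0 if_same.
Qed.

Lemma homog_deg_comp d p : homog_deg d (homog_comp d p).
Proof.
apply/homog_degP => m; rewrite mcoeff_homog_comp.
by case: (_ =P d) => // _; rewrite eqxx.
Qed.

Lemma homog_comp_id d p : homog_deg d p -> homog_comp d p = p.
Proof.
move=> /homog_degP ph; apply/mpolyP => m; rewrite mcoeff_homog_comp.
case: (_ =P d) => // /eqP; apply: contraNeq; rewrite eq_sym.
by move=> /ph ->.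
Qed.

Lemma homog_comp_is_zmod_morphism d : zmod_morphism (homog_comp d).
Proof.
move=> p q; apply/mpolyP => m; rewrite mcoeffB !mcoeff_homog_comp.
by case: ifP => _; rewrite ?mcoeffB ?subrr.
Qed.

HB.instance Definition _ d := GRing.isZmodMorphism.Build {mpoly k[n]} {mpoly k[n]}
  (homog_comp d) (homog_comp_is_zmod_morphism d).

(** This allows homogeneous parts to be taken entrywise in a matrix equation with a homogeneous
    right factor. *)
Lemma homog_compMr d e p q :
  homog_deg e q -> homog_comp (d + e) (p * q) = homog_comp d p * q.
Proof.
move=> /homog_degP qh; apply/mpolyP => m.
rewrite mcoeff_homog_comp !mcoeffM; set b := (X in if X then _ else _).
have -> : (if b then \sum_(l : 'X_{1..n < (mdeg m).+1, (mdeg m).+1}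
    | m == (l.1 + l.2)%MM) p@_l.1 * q@_l.2 else 0) = (\sum_(l : 'X_{1..n < (mdeg m).+1, (mdeg m).+1}
    | m == (l.1 + l.2)%MM) if b then p@_l.1 * q@_l.2 else 0).
  by case: b => //; rewrite big1.
apply: eq_bigr => -[[m1 lt1] [m2 lt2]] /= /eqP mE.
rewrite mcoeff_homog_comp; have [->|/qh m2d] := eqVneq q@_m2 0.
  by rewrite !mulr0 if_same.
have -> : b = ((mdeg m1)%:Z == d).
  by rewrite /b [in mdeg m]mE mdegD PoszD m2d (inj_eq (addIr _)).
by case: ifP => //; rewrite mul0r.
Qed.

Lemma homog_deg_mcoeff0 d p : homog_deg d p -> d != 0 -> p@_0%MM = 0.
Proof.
move=> /homog_degP ph; apply: contraNeq => /ph <-; by rewrite mdeg0.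
Qed.

End Homogeneous.

Section Comparison.

Variables (k : fieldType) (n : nat).
Variables (M : lmodType {mpoly k[n]}) (gr : int -> M -> Prop).
Implicit Types (F G : graded_free_resolution gr).

(** Projectivity of free modules: a map out of one lifts as soon as the image of each basis vector
    does. *)
Lemma mulmx_lift (R : pzRingType) m p q (D : 'M[R]_(p, q)) (B : 'M[R]_(m, q)) :
  (forall a, exists w, row a B = w *m D) -> exists X, B = X *m D.
Proof.
move=> /choice[w wP]; exists (\matrix_a w a).
by apply/row_matrixP => a; rewrite row_mul rowK.
Qed.

Lemma fdiff_mul F i : fdiff F i.+1 *m fdiff F i = 0.
Proof.
apply/row_matrixP => a; rewrite row_mul row0; apply/fdiff_exact.
by exists (delta_mx 0 a); rewrite -rowE.
Qed.

Lemma faug_fdiff F (v : 'rV_(frank F 1)) : faug F (v *m fdiff F 0) = 0.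
Proof. by apply/faug_exact; exists v. Qed.

Definition homog_mx F G i (X : 'M[{mpoly k[n]}]_(frank F i, frank G i)) : Prop :=
  forall a b, homog_deg (fdeg a - fdeg b) (X a b).

Definition chain_map F G (f : forall i, 'M[{mpoly k[n]}]_(frank F i, frank G i)) : Prop :=
  (forall v, faug G (v *m f 0) = faug F v) /\
  (forall i, fdiff F i *m f i = f i.+1 *m fdiff G i).

Section Lift.

Variables F G : graded_free_resolution gr.
Variable P : forall i, 'M[{mpoly k[n]}]_(frank F i, frank G i) -> Prop.
Variable X0 : 'M[{mpoly k[n]}]_(frank F 0, frank G 0).
Hypothesis augX0 : forall v, faug G (v *m X0) = faug F v.
Hypothesis PX0 : P X0.
Hypothesis PS : forall i (X : 'M_(frank F i, frank G i)) Y,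
  P X -> fdiff F i *m X = Y *m fdiff G i ->
  exists2 Z, fdiff F i *m X = Z *m fdiff G i & P Z.

(** The value 0 never occurs in [lift], since exactness always provides a [Y] to which [PS]
    applies. *)
Let next i (X : 'M_(frank F i, frank G i)) : 'M_(frank F i.+1, frank G i.+1) :=
  if pselect (exists2 Z, fdiff F i *m X = Z *m fdiff G i & P Z) is left h
  then s2val (cid2 h) else 0.

Let lift i : 'M_(frank F i, frank G i) :=
  nat_rect (fun i => 'M_(frank F i, frank G i)) X0 next i.

(** The comparison theorem, with a property [P] carried along the recursive choice of lifts: it is
    applied with no condition and with homogeneity. *)
Lemma chain_map_exists : exists2 f, @chain_map F G f & forall i, P (f i).
Proof.
have nextP i (X Y : 'M_(_, _)) : P X -> fdiff F i *m X = Y *m fdiff G i ->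
    fdiff F i *m X = next X *m fdiff G i /\ P (next X).
  move=> PX /(PS PX) h; rewrite /next; case: pselect => // h'.
  by case: cid2 => Z /= [].
suff H i : fdiff F i *m lift i = lift i.+1 *m fdiff G i /\ P (lift i.+1).
  exists lift; first by split=> [v|i]; rewrite ?augX0 //; have [] := H i.
  by case=> [//|i]; have [] := H i.
elim: i => [|i [IHi Pi]].
  have [Y YP] : exists Y, fdiff F 0 *m X0 = Y *m fdiff G 0.
    apply: mulmx_lift => a; apply/faug_exact.
    by rewrite row_mul augX0 rowE faug_fdiff.
  exact: nextP YP.
have [Y YP] : exists Y, fdiff F i.+1 *m lift i.+1 = Y *m fdiff G i.+1.
  apply: mulmx_lift => a; apply/fdiff_exact.
  by rewrite row_mul -mulmxA -IHi mulmxA -row_mul fdiff_mul row0 mul0mx.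
exact: nextP YP.
Qed.

End Lift.

Lemma chain_map_exists_any F G : exists f, @chain_map F G f.
Proof.
have [w wP] := choice (fun a => faug_surj G (faug F (delta_mx 0 a))).
pose X0 := \matrix_a w a.
have augX0 v : faug G (v *m X0) = faug F v.
  rewrite [in RHS](row_sum_delta v) mulmx_sum_row !linear_sum /=.
  by apply: eq_bigr => a _; rewrite !linearZ /= rowK wP.
have [f fP _] := @chain_map_exists F G (fun _ _ => True) X0 augX0 I
  (fun i X Y _ XY => ex_intro2 _ _ Y XY I).
by exists f.
Qed.

Lemma chain_map_exists_homog F G :
    (forall d x, gr d x -> exists2 v, faug G v = x &
       forall b, homog_deg (d - fdeg b) (v 0 b)) ->
  exists2 f, @chain_map F G f & forall i, homog_mx (f i).
Proof.
move=> H.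
have /choice[w wP] a : exists v, faug G v = faug F (delta_mx 0 a) /\
    forall b, homog_deg (fdeg a - fdeg b) (v 0 b).
  by have [v] := H _ _ (faug_homog a); exists v.
apply: (@chain_map_exists _ _ _ (\matrix_a w a)) => [v|a b|i X Y Xh XY].
- rewrite [in RHS](row_sum_delta v) mulmx_sum_row !linear_sum /=.
  by apply: eq_bigr => a _; rewrite !linearZ /= rowK (wP a).1.
- by rewrite mxE; apply: (wP a).2.
(* An arbitrary lift [Y] is replaced by its entrywise parts of the required degrees. The equation
   survives, because its left side and the entries of [fdiff G i] are homogeneous. *)
exists (\matrix_(a, b) homog_comp (fdeg a - fdeg b) (Y a b)); last first.
  by move=> a b; rewrite mxE; apply: homog_deg_comp.
apply/matrixP => a b.
rewrite -[LHS](@homog_comp_id _ _ (fdeg a - fdeg b)).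
  rewrite XY !mxE raddf_sum /=; apply: eq_bigr => c _; rewrite mxE.
  have -> : fdeg a - fdeg b = (fdeg a - fdeg c) + (fdeg c - fdeg b).
    by rewrite addrA subrK.
  by rewrite homog_compMr //; apply: fdiff_homog.
rewrite mxE; apply: homog_deg_sum => c _.
have -> : fdeg a - fdeg b = (fdeg a - fdeg c) + (fdeg c - fdeg b).
  by rewrite addrA subrK.
by apply: homog_degM; [apply: fdiff_homog | apply: Xh].
Qed.

Lemma chain_map_comp F G H f g :
  @chain_map F G f -> @chain_map G H g -> @chain_map F H (fun i => f i *m g i).
Proof.
move=> [f0 fS] [g0 gS]; split=> [v|i]; first by rewrite mulmxA g0 f0.
by rewrite mulmxA fS -!mulmxA gS.
Qed.

Lemma chain_map_homotopy0 F f : @chain_map F F f ->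
  exists h, f 0 = 1%:M + h *m fdiff F 0.
Proof.
move=> [f0 _]; have [h hP] : exists h, f 0 - 1%:M = h *m fdiff F 0.
  apply: mulmx_lift => a; apply/faug_exact.
  by rewrite rowE mulmxBr mulmx1 raddfB /= f0 subrr.
by exists h; rewrite -hP addrC subrK.
Qed.

(** A self-map over the identity of [M] is homotopic to the identity. The homotopy is built upwards:
    what [h] fails to correct is a cycle, and exactness lifts it to [h']. *)
Lemma chain_map_homotopyS F f i : @chain_map F F f ->
  exists h h', f i.+1 = 1%:M + fdiff F i *m h + h' *m fdiff F i.+1.
Proof.
move=> fP; have [f0 fS] := fP.
have step j h : fdiff F j *m f j = fdiff F j + fdiff F j *m h *m fdiff F j ->
    exists h', f j.+1 = 1%:M + fdiff F j *m h + h' *m fdiff F j.+1.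
  move=> dh; have [h' hP] : exists h',
      f j.+1 - 1%:M - fdiff F j *m h = h' *m fdiff F j.+1.
    apply: mulmx_lift => a; apply/fdiff_exact.
    by rewrite -row_mul !mulmxBl -fS mul1mx dh [X in X - _ - _]addrC addrK subrr row0.
  by exists h'; rewrite -hP -(addrA (f j.+1)) -opprD [RHS]addrC subrK.
elim: i => [|i [h [h' IHi]]].
  have [h hP] := chain_map_homotopy0 fP.
  have [|h' h'P] := step 0 h; first by rewrite hP mulmxDr mulmx1 mulmxA.
  by exists h, h'.
have [|h'' h''P] := step i.+1 h'; last by exists h', h''.
by rewrite IHi !mulmxDr mulmx1 !mulmxA fdiff_mul mul0mx addr0.
Qed.

End Comparison.

(** * Independence of Ext from the resolution, and comparison maps modulo the variables *)

Section Transfer.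

Variables (k : fieldType) (n : nat).
Variables (M : lmodType {mpoly k[n]}) (gr : int -> M -> Prop).
Implicit Types (F G : graded_free_resolution gr).

(** Up to a coboundary, [psi p *m (phi p *m z)] is [z], so a primitive of [f *: (phi p *m z)] on [F]
    yields one of [f *: z] on [G]. *)
Lemma subquo_ann_ext F G p f :
    subquo_ann (@ext_cocycle _ _ _ _ F p) (@ext_coboundary _ _ _ _ F p) f ->
  subquo_ann (@ext_cocycle _ _ _ _ G p) (@ext_coboundary _ _ _ _ G p) f.
Proof.
have [[phi phiP] [psi psiP]] := (chain_map_exists_any F G, chain_map_exists_any G F).
move=> fF z Zz; have [_ phiS] := phiP; have [_ psiS] := psiP.
have /fF : ext_cocycle (phi p *m z).
  by rewrite /ext_cocycle mulmxA phiS -mulmxA [_ *m z]Zz mulmx0.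
have hP := chain_map_comp psiP phiP.
case: p z Zz {fF} => [|p] z Zz /=.
  have [h hE] := chain_map_homotopy0 hP; move=> fz0.
  have <- : psi 0 *m (phi 0 *m z) = z.
    by rewrite mulmxA hE mulmxDl mul1mx -mulmxA [_ *m z]Zz mulmx0 addr0.
  by rewrite scalemxAr fz0 mulmx0.
case=> u fu; have [h [h' hE]] := chain_map_homotopyS p hP.
(* From psi phi z = z + d h z and f phi z = d u follows f z = d (psi u) - d (h (f z)). *)
exists (psi p *m u - h *m (f *: z)).
have zE : psi p.+1 *m (phi p.+1 *m z) = z + fdiff G p *m h *m z.
  by rewrite mulmxA hE !mulmxDl mul1mx -[h' *m _ *m z]mulmxA [fdiff G p.+1 *m z]Zz mulmx0 addr0.
rewrite mulmxBr !mulmxA psiS -[_ *m _ *m u]mulmxA -fu -!scalemxAr zE.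
by rewrite scalerDr addrK.
Qed.

Let c0 := [the {rmorphism {mpoly k[n]} -> k} of mcoeff 0%MM].

(** The product of [phi] and [psi] is homotopic to the identity, and the homotopy terms contain
    differentials of [F], which vanish modulo the variables. The sum is a diagonal entry of the
    reduced product. *)
Lemma minimal_mcoeff0 F G i phi psi (a : 'I_(frank F i)) :
    minimal_resolution F -> @chain_map _ _ _ _ F G phi ->
    @chain_map _ _ _ _ G F psi ->
  \sum_b (phi i a b)@_0%MM * (psi i b a)@_0%MM = 1.
Proof.
move=> Fmin phiP psiP; have d0 j : map_mx c0 (fdiff F j) = 0.
  by apply/matrixP => x y; rewrite !mxE /= Fmin.
have hP := chain_map_comp phiP psiP.
have : map_mx c0 (phi i *m psi i) = 1%:M.
  case: i {a} => [|i].
    have [h ->] := chain_map_homotopy0 hP.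
    by rewrite map_mxD map_mxM map_mx1 d0 mulmx0 addr0.
  have [h [h' ->]] := chain_map_homotopyS i hP.
  by rewrite !map_mxD !map_mxM map_mx1 !d0 mulmx0 mul0mx !addr0.
rewrite map_mxM => /matrixP/(_ a a); rewrite !mxE eqxx mulr1n => <-.
by apply: eq_bigr => b _; rewrite !mxE.
Qed.

(** Modulo the variables, column [a] of [psi] is a cocycle of Hom(G, k); dually, the next lemma
    makes row [a] of [phi] a cycle of the reduction of [G]. *)
Lemma minimal_psi_cocycle F G i psi a :
    minimal_resolution F -> @chain_map _ _ _ _ G F psi ->
  forall s, \sum_t (fdiff G i s t)@_0%MM * (psi i t a)@_0%MM = 0.
Proof.
move=> Fmin [_ psiS] s; have /(congr1 (map_mx c0)) := psiS i.
rewrite !map_mxM; have -> : map_mx c0 (fdiff F i) = 0.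
  by apply/matrixP => x y; rewrite !mxE /= Fmin.
rewrite mulmx0 => /matrixP/(_ s a); rewrite !mxE => dpsi0; rewrite -[RHS]dpsi0.
by apply: eq_bigr => b _; rewrite !mxE.
Qed.

Lemma minimal_phi_cycle F G i phi a :
    minimal_resolution F -> @chain_map _ _ _ _ F G phi ->
  forall t, \sum_s (phi i.+1 a s)@_0%MM * (fdiff G i s t)@_0%MM = 0.
Proof.
move=> Fmin [_ phiS] t; have /(congr1 (map_mx c0)) := phiS i.
rewrite !map_mxM; have -> : map_mx c0 (fdiff F i) = 0.
  by apply/matrixP => x y; rewrite !mxE /= Fmin.
rewrite mul0mx => /matrixP/(_ a t); rewrite !mxE => phid0; rewrite [RHS]phid0.
by apply: eq_bigr => b _; rewrite !mxE.
Qed.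

End Transfer.

(** * The ordered Taylor resolution *)

Section MonomialBasis.
Variables (k : fieldType) (n : nat).
Implicit Types (p q : {mpoly k[n]}) (m : 'X_{1..n}) (A : {set 'I_n}).

(** The k-linear, in general not S-linear, extension of a function on monomials; the contracting
    homotopy below is of this kind. *)
Definition monomial_ext (V : lmodType {mpoly k[n]}) (g : 'X_{1..n} -> V) p : V :=
  \sum_(m <- msupp p) (p@_m)%:MP *: g m.

Lemma monomial_extE (V : lmodType {mpoly k[n]}) (g : 'X_{1..n} -> V) p d :
    (msize p <= d)%N ->
  monomial_ext g p = \sum_(m : 'X_{1..n < d}) (p@_m)%:MP *: g m.
Proof.
move=> pd; rewrite /monomial_ext.
rewrite (big_mksub 'X_{1..n < d}) //=; first last.
- by move=> x /msize_mdeg_lt /leq_trans; apply.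
- by rewrite msupp_uniq.
by rewrite big_rmcond //= => m /memN_msupp_eq0 ->; rewrite mpolyC0 scale0r.
Qed.

Lemma monomial_extB (V : lmodType {mpoly k[n]}) (g : 'X_{1..n} -> V) :
  {morph monomial_ext g : p q / p - q}.
Proof.
move=> p q; pose d := maxn (msize (p - q)) (maxn (msize p) (msize q)).
rewrite !(@monomial_extE _ _ _ d) ?leq_max ?leqnn ?orbT //.
by rewrite -sumrB; apply: eq_bigr => m _; rewrite mcoeffB mpolyCB scalerBl.
Qed.

Lemma monomial_extZ (V : lmodType {mpoly k[n]}) (g : 'X_{1..n} -> V) c p :
  monomial_ext g (c%:MP * p) = c%:MP *: monomial_ext g p.
Proof.
pose d := maxn (msize (c%:MP * p)) (msize p).
rewrite !(@monomial_extE _ _ _ d) ?leq_max ?leqnn ?orbT //.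
by rewrite scaler_sumr; apply: eq_bigr => m _; rewrite mcoeffCM mpolyCM scalerA.
Qed.

Lemma monomial_extX (V : lmodType {mpoly k[n]}) (g : 'X_{1..n} -> V) m :
  monomial_ext g 'X_[m] = g m.
Proof. by rewrite /monomial_ext msuppX big_seq1 mcoeffX eqxx mpolyC1 scale1r. Qed.

Definition mnm_set (A : {set 'I_n}) : 'X_{1..n} := [multinom (i \in A : nat) | i < n].

Lemma mnm_setE A i : mnm_set A i = (i \in A). Proof. exact: mnmE. Qed.

Lemma mdeg_mnm_set A : mdeg (mnm_set A) = #|A|.
Proof.
rewrite mdegE -sum1_card [RHS]big_mkcond /=; apply: eq_bigr => i _.
by rewrite mnm_setE; case: (i \in A).
Qed.

Lemma mpolyX_mnm_set A : 'X_[mnm_set A] = \prod_(i in A) 'X_i :> {mpoly k[n]}.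
Proof.
rewrite mpolyXE_id [RHS]big_mkcond /=; apply: eq_bigr => i _.
by rewrite mnm_setE; case: (i \in A).
Qed.

Definition mnm_supp m : {set 'I_n} := [set i | m i != 0%N].

Lemma mnm_supp_addl m A : A \subset mnm_supp (m + mnm_set A)%MM.
Proof.
apply/subsetP => i iA; by rewrite inE mnmDE mnm_setE iA addn1.
Qed.

Lemma mnm_subK A m : A \subset mnm_supp m -> (m - mnm_set A + mnm_set A)%MM = m.
Proof.
move=> /subsetP Am; apply/mnmP => i; rewrite mnmDE mnmBE mnm_setE.
case: (boolP (i \in A)) => [/Am|_]; last by rewrite subn0 addn0.
by rewrite inE -lt0n => mi; rewrite subnK.
Qed.

Lemma mnm_sub_setD (A A' : {set 'I_n}) m : A \subset mnm_supp m -> A' \subset A ->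
  (m - mnm_set A + mnm_set (A :\: A'))%MM = (m - mnm_set A')%MM.
Proof.
move=> /subsetP Am /subsetP A'A; apply/mnmP => i.
rewrite mnmDE !mnmBE !mnm_setE inE.
have [/A'A ->|_] := boolP (i \in A'); first by rewrite addn0.
have [/Am|_] := boolP (i \in A); rewrite subn0 ?subn0 ?addn0 //.
by rewrite inE -lt0n => mi; rewrite subnK.
Qed.

End MonomialBasis.

Section Taylor.

Variables (k : fieldType) (n : nat) (Delta : {set {set 'I_n}}).

Local Notation S := {mpoly k[n]}.
Local Notation nonface := {A : {set 'I_n} | A \notin Delta}.
Local Notation cover s := (cover_seq (fun A : nonface => val A) s).
Implicit Types (s t : seq nonface) (m : 'X_{1..n}).

Definition taylor_rank i : nat := #|{: i.-tuple nonface}|.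

Definition taylor_seq i (a : 'I_(taylor_rank i)) : seq nonface := enum_val a.

Definition taylor_deg i (a : 'I_(taylor_rank i)) : int := #|cover (taylor_seq a)|.

(** The coefficient of [t] in the boundary of [s]. Entries may repeat, so several deletions can give
    the same [t], and their signs are added. *)
Definition incidence s t : k := altsum s (fun u => (u == t)%:R).

Definition taylor_diff i : 'M[S]_(taylor_rank i.+1, taylor_rank i) :=
  \matrix_(a, b) (incidence (taylor_seq a) (taylor_seq b) *:
    'X_[mnm_set (cover (taylor_seq a) :\: cover (taylor_seq b))]).

Lemma size_taylor_seq i (a : 'I_(taylor_rank i)) : size (taylor_seq a) = i.
Proof. exact: size_tuple. Qed.

Lemma taylor_seq_inj i : injective (@taylor_seq i).
Proof. by move=> a b /val_inj/enum_val_inj. Qed.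

Lemma taylor_seq_surj i s : size s = i -> exists a : 'I_(taylor_rank i), taylor_seq a = s.
Proof.
move=> /eqP si; exists (enum_rank (Tuple si)).
by rewrite /taylor_seq enum_rankK.
Qed.

Lemma incidence_eq0 s t : ~~ subseq t s -> incidence s t = 0.
Proof.
move=> ts; apply: altsum_eq0 => u _ us; case: eqP => // ut.
by rewrite -ut us in ts.
Qed.

(** The bridge from matrix sums to [altsum]: [incidence] is a signed sum of indicators, each
    selecting the unique index of one deletion, and additivity moves [f] inside. *)
Lemma sum_incidence (V : zmodType) (f : k -> seq nonface -> V) i s :
    size s = i.+1 -> (forall t, {morph f^~ t : x y / x - y}) ->
  \sum_(b < taylor_rank i) f (incidence s (taylor_seq b)) (taylor_seq b) =
  altsum s (f 1).
Proof.
move=> ss fB; have f0 t : f 0 t = 0 by have := fB t 0 0; rewrite /= !subrr.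
under eq_bigr do rewrite /incidence (altsum_morph _ _ (fB _)).
rewrite altsum_sum; apply: eq_altsum => t; rewrite ss => -[ti] _.
have [b bt] := taylor_seq_surj (esym ti).
rewrite (bigD1 b) //= bt eqxx big1 ?addr0 // => c; apply: contraNeq => fc.
apply/eqP/taylor_seq_inj; rewrite bt; apply/eqP; move: fc.
by apply: contraNT => /negPf ct; rewrite [t == _]eq_sym ct f0.
Qed.

Lemma taylor_diff_homog i a b :
  homog_deg (taylor_deg a - taylor_deg b) (taylor_diff i a b).
Proof.
rewrite mxE; have [ba|ba] := boolP (subseq (taylor_seq b) (taylor_seq a)); last first.
  by rewrite incidence_eq0 // scale0r; apply/homog_degP => m; rewrite mcoeff0 eqxx.
apply/homog_degP => m; rewrite mcoeffZ mcoeffX; case: (_ =P m) => [<- _|_]; last first.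
  by rewrite mulr0 eqxx.
have ba' := cover_seqS (fun A : nonface => val A) ba.
rewrite mdeg_mnm_set cardsD (setIidPr ba') /taylor_deg subzn //.
exact: subset_leq_card.
Qed.

(** The element of multidegree [m] on the generator [s]. Subtraction of exponents is truncated, so
    this reading requires the cover of [s] to lie in the support of [m]. *)
Definition taylor_basis i m s : 'rV[S]_(taylor_rank i) :=
  \row_b ('X_[m - mnm_set (cover s)] *+ (taylor_seq b == s)).

(** Within one multidegree the monomial coefficients are absorbed, and the Taylor differential
    becomes the plain alternating sum of deletions. *)
Lemma taylor_basis_diff i m s : size s = i.+1 -> cover s \subset mnm_supp m ->
  taylor_basis i.+1 m s *m taylor_diff i = altsum s (taylor_basis i m).
Proof.
move=> ss sm; apply/rowP => b; rewrite mxE.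
rewrite (altsum_morph (f := fun v : 'rV_ _ => v 0 b)); last first.
  by move=> x y; rewrite !mxE.
have [a aE] := taylor_seq_surj ss.
rewrite (bigD1 a) //= big1 ?addr0 => [|c /negPf ca]; last first.
  by rewrite mxE -aE (inj_eq (@taylor_seq_inj _)) ca mul0r.
rewrite !mxE aE eqxx /= mulr1n -scalerAr.
rewrite /incidence (altsum_morph (f := fun c : k => c *: _)); last first.
  by move=> x y; rewrite scalerBl.
apply: eq_altsum => t _ ts; rewrite mxE [t == _]eq_sym.
case: eqP => [bt|_]; last by rewrite scale0r.
rewrite scale1r -mpolyXD bt mnm_sub_setD //; exact: cover_seqS.
Qed.

Lemma taylor_basisE i (a : 'I_(taylor_rank i)) :
  delta_mx 0 a = taylor_basis i (mnm_set (cover (taylor_seq a))) (taylor_seq a).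
Proof.
apply/rowP => b; rewrite !mxE eqxx /= (inj_eq (@taylor_seq_inj _)).
suff -> : (mnm_set (cover (taylor_seq a)) - mnm_set (cover (taylor_seq a)))%MM = 0%MM.
  by rewrite mpolyX0.
by apply/mnmP => x; rewrite mnmBE subnn mnm0E.
Qed.

Lemma taylor_diffM i : taylor_diff i.+1 *m taylor_diff i = 0.
Proof.
apply/row_matrixP => a; rewrite rowE mulmxA taylor_basisE.
set s := taylor_seq a; have ss : size s = i.+2 := size_taylor_seq a.
have sm : cover s \subset mnm_supp (mnm_set (cover s)).
  by have := mnm_supp_addl 0%MM (cover s); rewrite add0m.
rewrite taylor_basis_diff // row0.
rewrite (altsum_morph (f := fun v => v *m taylor_diff i)); last first.
  by move=> x y; rewrite mulmxBl.
rewrite -[RHS](altsum_altsum s (taylor_basis i (mnm_set (cover s)))).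
apply: eq_altsum => t; rewrite ss => -[ti] ts.
by rewrite taylor_basis_diff // (subset_trans _ sm) // cover_seqS.
Qed.

(* The contracting homotopy prepends a nonface depending only on the
   multidegree [m], so that it commutes with the differential up to sign. *)
Definition taylor_cone i m s : 'rV[S]_(taylor_rank i.+1) :=
  if [pick A : nonface | val A \subset mnm_supp m] is Some A
  then taylor_basis i.+1 m (A :: s) else 0.

Definition taylor_homotopy i (v : 'rV[S]_(taylor_rank i)) :
    'rV[S]_(taylor_rank i.+1) :=
  \sum_a monomial_ext
    (fun m => taylor_cone i (m + mnm_set (cover (taylor_seq a)))%MM (taylor_seq a))
    (v 0 a).

Lemma taylor_homotopyB i : {morph @taylor_homotopy i : v w / v - w}.
Proof.
move=> v w; rewrite -sumrB; apply: eq_bigr => a _.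
by rewrite !mxE monomial_extB.
Qed.

Lemma taylor_homotopyZ i c v :
  @taylor_homotopy i (c%:MP *: v) = c%:MP *: taylor_homotopy v.
Proof.
rewrite scaler_sumr; apply: eq_bigr => a _.
by rewrite !mxE monomial_extZ.
Qed.

Lemma taylor_homotopy_basis i m s : size s = i -> cover s \subset mnm_supp m ->
  taylor_homotopy (taylor_basis i m s) = taylor_cone i m s.
Proof.
move=> si sm; have [a aE] := taylor_seq_surj si.
rewrite /taylor_homotopy (bigD1 a) //= big1 ?addr0 => [|c /negPf ca]; last first.
  rewrite mxE -aE (inj_eq (@taylor_seq_inj _)) ca mulr0n.
  by rewrite -(subrr 0) monomial_extB subrr.
by rewrite mxE aE eqxx mulr1n monomial_extX mnm_subK.
Qed.

Lemma taylor_rowE i (v : 'rV[S]_(taylor_rank i)) :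
  v = \sum_a \sum_(m <- msupp (v 0 a)) ((v 0 a)@_m)%:MP *:
    taylor_basis i (m + mnm_set (cover (taylor_seq a)))%MM (taylor_seq a).
Proof.
rewrite [LHS]row_sum_delta; apply: eq_bigr => a _.
rewrite [X in X *: _]mpolyE scaler_suml; apply: eq_bigr => m _.
rewrite -mul_mpolyC -scalerA; congr (_ *: _).
apply/rowP => b; rewrite !mxE eqxx /= (inj_eq (@taylor_seq_inj _)) addmK.
by case: (b == a); rewrite ?mulr1 ?mulr0.
Qed.

(** Both sides are k-linear, so it suffices to check the elements [taylor_basis]. There the cone
    with apex [A] satisfies d(A :: s) = s - (A :: d s). *)
Lemma taylor_homotopyP i (v : 'rV[S]_(taylor_rank i.+1)) :
  v = taylor_homotopy v *m taylor_diff i.+1 + taylor_homotopy (v *m taylor_diff i).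
Proof.
pose E v := taylor_homotopy v *m taylor_diff i.+1 + taylor_homotopy (v *m taylor_diff i).
have EB : {morph E : v w / v - w}.
  move=> x y; rewrite /E mulmxBl !taylor_homotopyB mulmxBl.
  by rewrite addrACA opprD.
have E0 : E 0 = 0 by have := EB 0 0; rewrite !subrr.
have ED : {morph E : v w / v + w}.
  by move=> x y; rewrite -{1}[y]opprK EB -[- y]sub0r EB E0 sub0r opprK.
have EZ c w : E (c%:MP *: w) = c%:MP *: E w.
  by rewrite /E -scalemxAl !taylor_homotopyZ -scalemxAl scalerDr.
change (v = E v); rewrite [in RHS](taylor_rowE v) [LHS](taylor_rowE v).
rewrite (big_morph _ ED E0); apply: eq_bigr => a _.
rewrite (big_morph _ ED E0); apply: eq_bigr => m' _.
rewrite EZ; congr (_ *: _); move: (m' + _)%MM (mnm_supp_addl m' (cover (taylor_seq a))).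
move: (taylor_seq a) (size_taylor_seq a) => s ss m sm {m' a v}.
rewrite /E taylor_homotopy_basis // taylor_basis_diff //.
rewrite (altsum_morph _ _ (@taylor_homotopyB i)).
rewrite [X in _ + X](@eq_altsum _ _ _ _ (taylor_cone i m)); last first.
  move=> t; rewrite ss => -[ti] ts.
  by rewrite taylor_homotopy_basis // (subset_trans _ sm) // cover_seqS.
rewrite /taylor_cone; case: pickP => [A Am|noA].
  rewrite taylor_basis_diff /= ?ss ?subrK //.
  by rewrite cover_seq_cons subUset Am.
(* When no nonface lies in the support of [m], no nonempty tuple occurs in this multidegree. *)
case: s ss sm => // A s _; rewrite cover_seq_cons subUset => /andP[Am _].
by have := noA A; rewrite Am.
Qed.

Lemma taylor_exact i (v : 'rV[S]_(taylor_rank i.+1)) :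
  v *m taylor_diff i = 0 <-> exists w, v = w *m taylor_diff i.+1.
Proof.
split=> [v0|[w ->]]; last by rewrite -mulmxA taylor_diffM mulmx0.
exists (taylor_homotopy v); rewrite [LHS]taylor_homotopyP v0.
by rewrite -[X in _ + taylor_homotopy X](subrr 0) taylor_homotopyB subrr addr0.
Qed.

Lemma taylor_rank0 : exists b0 : 'I_(taylor_rank 0), forall b, b = b0.
Proof.
have [b0 b0E] := taylor_seq_surj (erefl (size [::])).
exists b0 => b; apply: taylor_seq_inj; rewrite b0E.
by apply: size0nil; rewrite size_taylor_seq.
Qed.

Definition taylor_idx0 : 'I_(taylor_rank 0) := enum_rank [tuple].

Lemma taylor_idx0E b : b = taylor_idx0.
Proof. by have [b0 b0P] := taylor_rank0; rewrite (b0P b) (b0P taylor_idx0). Qed.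

Definition taylor_aug (v : 'rV[S]_(taylor_rank 0)) : SR_ring k Delta :=
  SR_pi Delta (v 0 taylor_idx0).

Lemma taylor_aug_is_linear : linear taylor_aug.
Proof.
move=> a u v; rewrite /taylor_aug !mxE SR_piD; congr (_ + _).
by rewrite -SR_scale_pi.
Qed.

HB.instance Definition _ := GRing.isLinear.Build S 'rV[S]_(taylor_rank 0)
  (SR_ring k Delta) _ taylor_aug taylor_aug_is_linear.

Lemma taylor_aug_eq0 v : taylor_aug v = 0 <-> v 0 taylor_idx0 \in @SR_ideal k n Delta.
Proof.
have -> : 0 = SR_pi Delta 0 :> SR_ring k Delta by rewrite /SR_pi !piE.
by rewrite -[X in X \in _]subr0 -SR_piP; split => /eqP.
Qed.

Lemma prod_nonface_in A : A \notin Delta ->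
  \prod_(i in A) 'X_i \in @SR_ideal k n Delta.
Proof.
move=> AD; apply/asboolP; exists (fun B => (B == A)%:R).
rewrite [RHS](bigD1 A) //= eqxx mul1r [X in _ + X]big1 ?addr0 // => B /andP[_ /negPf ->].
by rewrite mul0r.
Qed.

Lemma taylor_diff0 a b A : taylor_seq a = [:: A] ->
  taylor_diff 0 a b = \prod_(i in val A) 'X_i.
Proof.
move=> aE; rewrite mxE aE (size0nil (size_taylor_seq b)) /incidence /= subr0.
rewrite scale1r cover_seq_cons [cover [::]]big_nil setU0 setD0.
exact: mpolyX_mnm_set.
Qed.

Lemma taylor_aug_exact v :
  taylor_aug v = 0 <-> exists w, v = w *m taylor_diff 0.
Proof.
rewrite taylor_aug_eq0; split=> [/asboolP[c vE]|[w ->]]; last first.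
  rewrite mxE; elim/big_ind: _ => [|p q pI qI|a _]; first exact: SR_ideal0.
    by rewrite -[p]mul1r SR_idealMD.
  have : size (taylor_seq a) = 1 := size_taylor_seq a.
  case aE: (taylor_seq a) => [|A []] // _.
  rewrite (taylor_diff0 _ aE) -[_ * _]addr0 SR_idealMD ?SR_ideal0 //.
  exact: prod_nonface_in (valP A).
(* The inner sum has one term, as [taylor_seq a] has length 1; it reads off the single nonface
   without naming it. *)
exists (\row_a (\sum_(A <- taylor_seq a) c (val A))).
apply/rowP => b; rewrite [b in LHS]taylor_idx0E vE mxE.
pose f (A : nonface) : 'I_(taylor_rank 1) := enum_rank [tuple A].
have fE A : taylor_seq (f A) = [:: A] by rewrite /taylor_seq enum_rankK.
rewrite [RHS](reindex f) /=; last first.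
  exists (fun a => thead (enum_val a)) => [A _|a _]; first by rewrite enum_rankK.
  apply: enum_val_inj; rewrite enum_rankK; apply: val_inj => /=.
  by case: (enum_val a) => -[|A []] // sz; rewrite /thead (tnth_nth A).
under [RHS]eq_bigr => A _ do rewrite mxE fE big_seq1 (taylor_diff0 _ (fE A)).
exact: big_sub.
Qed.

Lemma taylor_aug_homog a :
  SR_graded (taylor_deg a) (taylor_aug (delta_mx 0 a)).
Proof.
rewrite [a]taylor_idx0E; exists 1; last by rewrite /taylor_aug mxE !eqxx.
rewrite /taylor_deg (size0nil (size_taylor_seq _)) [cover [::]]big_nil cards0 /=.
exact: dhomog1.
Qed.

Lemma taylor_aug_surj (x : SR_ring k Delta) : exists v, taylor_aug v = x.
Proof.
by have [p ->] := SR_pi_surj x; exists (\row_b p); rewrite /taylor_aug mxE.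
Qed.

Definition taylor : graded_free_resolution (@SR_graded k n Delta) :=
  @GradedFreeResolution k n (SR_ring k Delta) (@SR_graded k n Delta)
  taylor_rank taylor_deg taylor_diff taylor_aug taylor_diff_homog
  taylor_aug_homog taylor_aug_surj taylor_aug_exact taylor_exact.

(** T_0 is S with its generator in degree 0, so a homogeneous representative is already a lift. This
    is the hypothesis of [chain_map_exists_homog]. *)
Lemma taylor_aug_homog_lift d (x : SR_ring k Delta) : SR_graded d x ->
  exists2 v, faug taylor v = x & forall b, homog_deg (d - fdeg b) (v 0 b).
Proof.
case=> p pd ->; exists (\row_b p); first by rewrite /= /taylor_aug mxE.
move=> b; rewrite mxE /= /taylor_deg (size0nil (size_taylor_seq _)).
by rewrite [cover [::]]big_nil cards0 subr0.
Qed.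

End Taylor.

(** * Primes generated by variables *)

Section VariablePrimes.

Variables (k : fieldType) (n : nat).
Implicit Types (f : {mpoly k[n]}) (U : {set 'I_n}) (m : 'X_{1..n}).

Definition kill_vars U f : {mpoly k[n]} :=
  f \mPo [tuple if i \in U then 0 else 'X_i | i < n].

Lemma mcoeff_kill_vars U f m :
  (kill_vars U f)@_m = if [disjoint U & mnm_supp m] then f@_m else 0.
Proof.
have killX m' : \prod_(i < n) tnth [tuple if i \in U then 0 else 'X_i | i < n] i ^+ m' i =
    if [disjoint U & mnm_supp m'] then 'X_[m'] else 0 :> {mpoly k[n]}.
  case: ifPn => [dU|].
    rewrite mpolyXE_id; apply: eq_bigr => i _; rewrite tnth_mktuple.
    case: ifPn => // /(disjointFr dU); rewrite inE => /negbFE/eqP ->.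
    by rewrite !expr0.
  case/pred0Pn => i /andP[/= iU]; rewrite inE => mi.
  by rewrite (bigD1 i) //= tnth_mktuple iU expr0n (negPf mi) mul0r.
rewrite /kill_vars comp_mpolyE raddf_sum /=.
under eq_bigr => m' _ do rewrite killX mcoeffZ.
have [mf|mf] := boolP (m \in msupp f); last first.
  have fm : f@_m = 0 by apply/eqP; rewrite mcoeff_eq0.
  rewrite fm if_same big_seq big1 // => m' m'f; case: ifP => _; last first.
    by rewrite mcoeff0 mulr0.
  rewrite mcoeffX; case: (m' =P m) => [m'm|_]; last by rewrite mulr0.
  by rewrite -m'm m'f in mf.
rewrite (bigD1_seq m) //= big1 ?addr0 => [|m' /negPf m'm]; last first.
  by case: ifP => _; rewrite ?mcoeffX ?m'm ?mcoeff0 mulr0.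
by case: ifP => _; rewrite ?mcoeffX ?eqxx ?mcoeff0 ?mulr1 ?mulr0.
Qed.

(** The ideal generated by the x_u with u in [U], taken as the kernel of a ring map to a domain,
    which makes it prime. *)
Definition var_ideal U : {pred {mpoly k[n]}} := fun f => kill_vars U f == 0.

Lemma var_idealP U f :
  reflect (forall m, [disjoint U & mnm_supp m] -> f@_m = 0) (f \in var_ideal U).
Proof.
apply: (iffP eqP) => [f0 m dm|f0].
  by have := mcoeff_kill_vars U f m; rewrite dm f0 mcoeff0 => <-.
by apply/mpolyP => m; rewrite mcoeff_kill_vars mcoeff0; case: ifP => // /f0.
Qed.

Lemma var_ideal_closed U : idealr_closed (var_ideal U).
Proof.
split.
- by apply/eqP; rewrite /kill_vars comp_mpoly0.
- by rewrite unfold_in /kill_vars comp_mpoly1 oner_eq0.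
move=> a u v /eqP u0 /eqP v0; apply/eqP.
by rewrite /kill_vars comp_mpolyD rmorphM /= [u \mPo _]u0 [v \mPo _]v0 mulr0 addr0.
Qed.

Lemma var_ideal_prime U : prime_idealr_closed (var_ideal U).
Proof.
by move=> u v; rewrite !unfold_in /kill_vars rmorphM mulf_eq0.
Qed.

Lemma var_idealS U U' : U \subset U' -> {subset var_ideal U <= var_ideal U'}.
Proof.
move=> UU' f /var_idealP f0; apply/var_idealP => m dm; apply: f0.
exact: disjointWl dm.
Qed.

Lemma var_idealX U i : ('X_i \in var_ideal U) = (i \in U).
Proof.
rewrite unfold_in /kill_vars comp_mpolyXU -tnth_nth tnth_mktuple.
case: ifP => _; rewrite ?eqxx //; apply/negP => /eqP/(congr1 (mcoeff U_(i)%MM)).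
by rewrite mcoeffXU eqxx mcoeff0 => /eqP; rewrite oner_eq0.
Qed.

(** The chain starts at [var_ideal U] and adjoins the remaining variables one at a time, in the
    order of [enum (~: U)]. *)
Lemma krull_dim_ge_var_ideal (V : lmodType {mpoly k[n]}) (Z B : V -> Prop) U c :
    (forall f, subquo_ann Z B f -> f \in var_ideal U) ->
  c <= #|~: U|%:Z -> krull_dim_ge Z B c.
Proof.
move=> annU cU; exists #|~: U|; split=> //.
pose Us i := U :|: [set x in take i (enum (~: U))].
exists (fun i => var_ideal (Us i)); split=> [i _|i].
  split=> [||f /annU]; [exact: var_ideal_closed | exact: var_ideal_prime |].
  exact/var_idealS/subsetUl.
rewrite cardE => iU; have [x0 _] : exists x0 : 'I_n, true.
  by case: (enum (~: U)) iU => // x; exists x.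
have takeS := take_nth x0 iU.
split.
  apply/var_idealS/setUS/subsetP => x; rewrite !inE takeS mem_rcons inE.
  by move->; rewrite orbT.
exists 'X_(nth x0 (enum (~: U)) i); rewrite var_idealX !inE.
  by rewrite takeS mem_rcons inE eqxx orbT.
rewrite negb_or -in_setC -mem_enum mem_nth //=.
have := take_uniq i.+1 (enum_uniq (~: U)).
by rewrite takeS rcons_uniq => /andP[].
Qed.

End VariablePrimes.

(** * Tor and Ext of the Taylor resolution *)

Section TaylorExt.

Variables (k : fieldType) (n : nat) (Delta : {set {set 'I_n}}).

Local Notation S := {mpoly k[n]}.
Local Notation nonface := {A : {set 'I_n} | A \notin Delta}.
Local Notation lab := (fun A : nonface => val A).
Local Notation cover s := (cover_seq lab s).
Local Notation T := (taylor k Delta).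

(** A nonzero constant term occurs only between tuples with equal covers, so modulo the variables
    the dual complex splits into the C(W, W). *)
Lemma taylor_diff_mcoeff0 i (a : 'I_(taylor_rank Delta i.+1))
    (b : 'I_(taylor_rank Delta i)) :
  (fdiff T i a b)@_0%MM =
  incidence k (taylor_seq a) (taylor_seq b) *
    (cover (taylor_seq a) \subset cover (taylor_seq b))%:R.
Proof.
rewrite /= mxE mcoeffZ mcoeffX; congr (_ * _%:R); rewrite -setD_eq0 -cards_eq0.
by rewrite -mdeg_mnm_set mdeg_eq0.
Qed.

(** Modulo the variables, column [a] of [psi] is a cocycle [z], row [a] of [phi] is a cycle
    supported on covers of cardinality [e] by homogeneity, and they pair to 1. Were [z] a coboundary
    on every C(W, W) with [#|W| = e], the pairing would be 0. *)
Lemma tor_has_cohomology (F : graded_free_resolution (@SR_graded k n Delta))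
    i e (a : 'I_(frank F i)) :
    minimal_resolution F -> fdeg a = Posz e ->
  exists2 W : {set 'I_n}, #|W| = e & has_cohomology k lab W W i.
Proof.
move=> Fmin ae.
have [phi phiP phih] := chain_map_exists_homog F (@taylor_aug_homog_lift k n Delta).
have [psi psiP] := chain_map_exists_any T F.
pose z t := \sum_b (psi i b a)@_0%MM *+ (@taylor_seq _ Delta i b == t).
have zE b : z (taylor_seq b) = (psi i b a)@_0%MM.
  rewrite /z (bigD1 b) //= eqxx big1 ?addr0 // => c /negPf cb.
  by rewrite (inj_eq (@taylor_seq_inj _ _ _)) cb.
have zcoc W : cocycle lab W W i z.
  move=> s ss sW; have [Ws|/altsum_above_eq0-> //] := boolP (W \subset cover s).
  have {Ws sW} -> : W = cover s by apply/eqP; rewrite eqEsubset Ws sW.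
  have [a' a's] := taylor_seq_surj ss.
  rewrite -[RHS](minimal_psi_cocycle a Fmin psiP a').
  transitivity (altsum s (fun t => 1 * above lab (cover s) z t)).
    by apply: eq_altsum => t _ _; rewrite mul1r.
  rewrite -(@sum_incidence k n Delta _ (fun c t => c * above lab (cover s) z t) i) //.
    apply: eq_bigr => b _; rewrite taylor_diff_mcoeff0 a's -zE /above.
    by case: ifP => _; rewrite ?mulr1 ?mulr0 ?mul0r.
  by move=> t x y; rewrite mulrBl.
have [//|noW] := EM (exists2 W : {set 'I_n}, #|W| = e & has_cohomology k lab W W i).
have cob (W : {set 'I_n}) : exists y, #|W| = e -> forall s, size s = i -> cover s = W ->
    z s = altsum s (above lab W y).
  have [We|] := eqVneq #|W| e; last by move=> /eqP We; exists z => /We.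
  have [[y yP]|zW] := EM (coboundary lab W W i z).
    by exists y => _ s ss sW; apply: yP; rewrite ?sW.
  by case: noW; exists W => //; exists z.
(* The primitives for the various [W] glue, since C(W, W) only involves tuples with cover exactly
   [W]. *)
have {cob} [Y YP] := choice cob; pose y t := Y (cover t) t.
have := minimal_mcoeff0 a Fmin phiP psiP.
have phiz b : (phi i a b)@_0%MM * (psi i b a)@_0%MM =
    (phi i a b)@_0%MM * altsum (taylor_seq b) (above lab (cover (taylor_seq b)) y).
  have [->|phi0] := eqVneq (phi i a b)@_0%MM 0; first by rewrite !mul0r.
  have be : #|cover (taylor_seq b)| = e.
    apply: contraNeq phi0 => be; apply/eqP.
    apply: homog_deg_mcoeff0 (phih i a b) _.
    by rewrite subr_eq0 ae eqz_nat eq_sym.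
  congr (_ * _); rewrite -zE (YP _ be) ?size_taylor_seq //.
  apply: eq_altsum => t _ /cover_seqS tb; rewrite /above; case: ifP => // bt.
  by rewrite /y; congr (Y _ t); apply/eqP; rewrite eqEsubset tb bt.
rewrite (eq_bigr _ (fun b _ => phiz b)) => /eqP; rewrite eq_sym.
(* In degree 0 coboundaries vanish. In higher degrees the pairing of [phi] with the coboundary of
   [y] equals that of the boundary of [phi] with [y], which is 0. *)
case: i a {ae z zE zcoc noW YP phiz} y => [|i] a y.
  rewrite big1 ?oner_eq0 // => b _.
  by rewrite (size0nil (size_taylor_seq b)) mulr0.
rewrite (eq_bigr (fun b => \sum_t (phi i.+1 a b)@_0%MM *
    (fdiff T i b t)@_0%MM * y (taylor_seq t))).
  rewrite exchange_big big1 ?oner_eq0 //= => t _.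
  by rewrite -mulr_suml (minimal_phi_cycle a Fmin phiP t) mul0r.
move=> b _; rewrite -(eq_bigr _ (fun t _ => mulrA _ _ _)) -mulr_sumr.
congr (_ * _).
set s := taylor_seq b; have ss : size s = i.+1 := size_taylor_seq b.
transitivity (altsum s (fun t => 1 * above lab (cover s) y t)).
  by apply: eq_altsum => t _ _; rewrite mul1r.
rewrite -(@sum_incidence k n Delta _ (fun c t => c * above lab (cover s) y t) i) //.
  apply: eq_bigr => t _; rewrite taylor_diff_mcoeff0 /above.
  by case: ifP => _; rewrite ?mulr1 ?mulr0 ?mul0r.
by move=> t u v; rewrite mulrBl.
Qed.

(** The class gives the Ext cocycle [w] with entries z(t) times the monomial of cover(t) minus U. If
    a monomial x^m of [f] avoided [U], comparing coefficients of [f *: w] and of a coboundary at the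
    exponents [M s] would exhibit [z] as a coboundary, after division by [f@_m]. *)
Lemma taylor_ext_ann U p (f : S) : has_cohomology k lab setT U p ->
    subquo_ann (@ext_cocycle _ _ _ _ T p) (@ext_coboundary _ _ _ _ T p) f ->
  f \in var_ideal U.
Proof.
move=> [z zcoc zncob] fann; apply/var_idealP => m dm.
apply: contra_notP zncob => /eqP fm.
pose w : 'cV[S]_(taylor_rank Delta p) := \col_b
  (above lab U z (taylor_seq b) *: 'X_[mnm_set (cover (taylor_seq b) :\: U)]).
have /fann : ext_cocycle (F := T) w.
  apply/colP => a; rewrite !mxE.
  set s := taylor_seq a; have ss : size s = p.+1 := size_taylor_seq a.
  pose g (c : k) t := (c * above lab U z t) *: 'X_[mnm_set (cover s :\: U)] : S.
  transitivity (altsum s (g 1)).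
    rewrite -(@sum_incidence k n Delta _ g p) //; last first.
      by move=> t x y; rewrite /g mulrBl scalerBl.
    apply: eq_bigr => b _; rewrite !mxE -/s /g.
    have [bs|/incidence_eq0->] := boolP (subseq (taylor_seq b) s); last first.
      by rewrite mul0r !scale0r mul0r.
    rewrite /above; case: ifP => Ub; last by rewrite mulr0 !scale0r mulr0.
    rewrite -scalerAl -scalerAr scalerA -mpolyXD; congr (_ *: 'X_[_]).
    have := cover_seqS lab bs; move: (cover s) (cover _) Ub => B A UA AB.
    apply/mnmP => i; rewrite mnmDE !mnm_setE !inE.
    have [/(subsetP UA) ->|_] := boolP (i \in U); first by [].
    by have [/(subsetP AB) ->|_] := boolP (i \in A); rewrite /= ?addn0 ?add0n.
  rewrite -[RHS](scale0r 'X_[mnm_set (cover s :\: U)]) -(zcoc s ss (subsetT _)).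
  rewrite [RHS](altsum_morph (f := fun c : k => c *: _)); last first.
    by move=> x y; rewrite scalerBl.
  by apply: eq_altsum => t _ _; rewrite /g mul1r.
pose M s := (mnm_set (cover s :\: U) + m)%MM.
have fw (b : 'I_(taylor_rank Delta p)) : U \subset cover (taylor_seq b) ->
    ((f *: w) b 0)@_(M (taylor_seq b)) = z (taylor_seq b) * f@_m.
  move=> Ub; rewrite !mxE -scalerAr mcoeffZ; congr (_ * _); last exact: mcoeffMX.
  by rewrite /above Ub.
case: p @w zcoc {fann} fw => [|p] w zcoc fw /= => [fw0|[u fwu]].
  exists z => s ss Us _; have [b bs] := taylor_seq_surj ss.
  have := fw b; rewrite bs fw0 mxE mcoeff0 => /(_ Us)/esym/eqP.
  by rewrite mulf_eq0 (negPf fm) orbF (size0nil ss) => /eqP.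
exists (fun t => (\sum_b (u b 0)@_(M t) *+ (taylor_seq b == t)) / f@_m).
move=> s ss Us _; have [a aE] := taylor_seq_surj ss.
apply: (mulIf fm); have := fw a; rewrite aE => /(_ Us) <-.
rewrite fwu mxE raddf_sum /=.
pose v t := \sum_b (u b 0)@_(M t) *+ (taylor_seq b == t).
pose g (c : k) t := c * above lab U v t.
transitivity (altsum s (g 1)).
  rewrite -(@sum_incidence k n Delta _ g p) //; last first.
    by move=> t x y; rewrite /g mulrBl.
  apply: eq_bigr => b _; rewrite mxE aE /g.
  have [bs|/incidence_eq0->] := boolP (subseq (taylor_seq b) s); last first.
    by rewrite scale0r !mul0r mcoeff0.
  rewrite -scalerAl mcoeffZ; congr (_ * _); rewrite mulrC /above.
  have bs' := cover_seqS lab bs; case: ifPn => [Ub|/subsetPn[x xU xb]].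
    rewrite /v (bigD1 b) //= eqxx big1 ?addr0 => [|c /negPf cb]; last first.
      by rewrite (inj_eq (@taylor_seq_inj _ _ _)) cb.
    rewrite -(mcoeffMX (u b 0) (mnm_set (cover s :\: cover (taylor_seq b)))); congr (_@_ _).
    move: bs' Ub; rewrite /M; move: (cover s) (cover _) => B A AB UA.
    apply/mnmP => i; rewrite !mnmDE !mnm_setE !inE addnA.
    have [/(subsetP UA) ->|_] := boolP (i \in U); first by [].
    by have [/(subsetP AB) ->|_] := boolP (i \in A); rewrite /= ?addn0 ?add0n.
  (* A tuple missing some [x] in [U] contributes nothing: its matrix entry is divisible by the
     variable [x], whereas [M s] has exponent 0 there. *)
  apply/eqP; rewrite mcoeff_eq0 (perm_mem (msuppMX _ _)).
  apply/mapP => -[m' _ /mnmP/(_ x)]; rewrite /M !mnmDE !mnm_setE !inE.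
  rewrite xU xb (subsetP Us _ xU) /= add0n.
  by have := disjointFr dm xU; rewrite inE => /negbFE/eqP ->.
rewrite (altsum_morph (f := fun c => c * f@_m)); last by move=> x y; rewrite mulrBl.
apply: eq_altsum => t _ _; rewrite /g mul1r /above -/(v t).
by case: ifP => _; rewrite ?mul0r // divfK.
Qed.

End TaylorExt.

(** * Degrees in a minimal resolution, and from Betti numbers to dimensions *)

Section MinimalResolution.

Variables (k : fieldType) (n : nat) (Delta : {set {set 'I_n}}).
Variable F : graded_free_resolution (@SR_graded k n Delta).
Hypothesis Fmin : minimal_resolution F.

Let c0 := [the {rmorphism {mpoly k[n]} -> k} of mcoeff 0%MM].

Lemma minimal_delta_not_boundary i (a : 'I_(frank F i)) w :
  (delta_mx 0 a : 'rV_(frank F i)) <> w *m fdiff F i.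
Proof.
move=> /matrixP/(_ 0 a)/(congr1 c0); rewrite !mxE !eqxx rmorph1 raddf_sum /=.
rewrite big1 => [/eqP|b _]; first by rewrite oner_eq0.
by rewrite (rmorphM c0) /= Fmin mulr0.
Qed.

(** By minimality a nonzero entry of a differential has positive degree, and row [a] is nonzero,
    since otherwise a basis vector would be a cycle and hence a boundary. This makes [j] nonnegative
    whenever beta_(i,i+j) is nonzero. *)
Lemma minimal_fdeg_ge i (a : 'I_(frank F i)) : i%:Z <= fdeg a.
Proof.
elim: i a => [|i IHi] a.
  have := faug_homog a; case: (fdeg a) => // d [p /= -> e0].
  have /faug_exact[w] : faug F (delta_mx 0 a) = 0.
    by rewrite e0 /SR_pi !piE.
  by move/minimal_delta_not_boundary.
have [[b dab]|noB] := EM (exists b, fdiff F i a b != 0); last first.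
  have /fdiff_exact[w] : delta_mx (0 : 'I_1) a *m fdiff F i = 0.
    rewrite -rowE; apply/rowP => b; rewrite !mxE; apply/eqP.
    by apply: contra_notT noB => dab; exists b.
  by move/minimal_delta_not_boundary.
have [m md] : exists m, (fdiff F i a b)@_m != 0.
  apply: contra_notP (elimN eqP dab) => no; apply/mpolyP => m; rewrite mcoeff0.
  by apply/eqP; apply: contra_notT no => ?; exists m.
have mdeg_m := (homog_degP _ _).1 (fdiff_homog a b) m md.
have m_gt0 : (0 < mdeg m)%N.
  by rewrite lt0n mdeg_eq0; apply: contraNneq md => ->; rewrite Fmin.
rewrite -(subrK (fdeg b) (fdeg a)) -mdeg_m -add1n PoszD.
by rewrite lerD // lez_nat.
Qed.

(** Otherwise 1 would be congruent modulo the Stanley-Reisner ideal to a polynomial without constant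
    term; but that ideal has no constant terms when the empty set is a face. *)
Lemma minimal_fdeg0 : set0 \in Delta -> exists a : 'I_(frank F 0), fdeg a = 0.
Proof.
move=> D0; apply: contrapT => noa.
have /choice[p pP] a : exists p : {mpoly k[n]},
    p@_0%MM = 0 /\ faug F (delta_mx 0 a) = SR_pi Delta p.
  have [p ph pE] := faug_homog a; exists p; split=> //.
  by apply: homog_deg_mcoeff0 ph _; apply: contra_notN noa => /eqP; exists a.
have [v vE] := faug_surj F (SR_pi Delta 1).
have pi_sum (I : Type) (r : seq I) (g : I -> {mpoly k[n]}) :
    \sum_(i <- r) SR_pi Delta (g i) = SR_pi Delta (\sum_(i <- r) g i).
  rewrite (big_morph (SR_pi Delta) (@SR_piD k n Delta) (id1 := 0)) //.
  by rewrite /SR_pi !piE.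
have : SR_pi Delta (\sum_a v 0 a * p a) = SR_pi Delta 1.
  rewrite -pi_sum -vE [in RHS](row_sum_delta v) linear_sum /=.
  by apply: eq_bigr => a _; rewrite linearZ /= (pP a).2 -SR_scale_pi.
move/eqP; rewrite SR_piP => /asboolP[c /(congr1 c0)].
rewrite raddfB !raddf_sum /= mcoeff1 eqxx.
rewrite big1 => [|a _]; last by rewrite (rmorphM c0) /= (pP a).1 mulr0.
rewrite big1 => [/eqP|A AD]; first by rewrite sub0r oppr_eq0 oner_eq0.
rewrite (rmorphM c0) /= -mpolyX_mnm_set mcoeffX -mdeg_eq0 mdeg_mnm_set cards_eq0.
by case: eqP AD => [->|]; rewrite ?D0 // mulr0.
Qed.

Lemma betti_dim_K i (j : int) r : j < r%:Z -> betti F i (i%:Z + j) <> 0%N ->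
  exists2 l, (l + i <= n)%N & dim_K_ge F l (l%:Z - r%:Z + 1).
Proof.
move=> jr /eqP; rewrite cards_eq0 => /set0Pn[a]; rewrite inE => /eqP ae.
have := minimal_fdeg_ge a; rewrite ae lerDl.
case: j jr ae => // j; rewrite ltz_nat => jr ae _.
rewrite -PoszD in ae; have [W We hW] := tor_has_cohomology Fmin ae.
have [U [WU hU]] := has_cohomology_setT hW (subxx W).
have cWU := subset_leq_card WU; have cU := max_card U; rewrite card_ord in cU.
have cCU := cardsC U; rewrite card_ord in cCU; rewrite We in cWU hU.
have pE : (n - (#|~: U| + j) = i + (#|U| - (i + j)))%N by lia.
(* For this l, n - l = [#|U|] - j is the degree of the class [hU], and l + i <= n because [#|U|] is
   at least i + j. *)
exists (#|~: U| + j)%N; first by lia.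
split; first by lia.
rewrite pE; apply: (@krull_dim_ge_var_ideal _ _ _ _ _ U); last by lia.
move=> f fann; apply: taylor_ext_ann hU _.
exact: subquo_ann_ext fann.
Qed.

End MinimalResolution.

Theorem theorem1p1 (k : fieldType) (n : nat) (Delta : {set {set 'I_n}})
    (r : nat) (hDelta : simplicial_complex Delta) (hpure : pure Delta)
    (hr : (2 <= r)%N)
    (F : graded_free_resolution (@SR_graded k n Delta))
    (hF : minimal_resolution F) :
  exists m s : nat,
    [/\ is_linear_length F r m, is_serre_depth F r s & (m <= n - s)%N].
Proof.
pose P i := exists j : int, j < r%:Z /\ betti F i (i%:Z + j) <> 0%N.
pose Q l := dim_K_ge F l (l%:Z - r%:Z + 1).
have PQ i : P i -> exists2 l, (l + i <= n)%N & Q l.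
  by case=> j [jr bj]; apply: betti_dim_K jr bj.
have D0 : set0 \in Delta.
  have [/set0Pn[A AD] sub] := hDelta; exact: sub AD (sub0set A).
(* The generator of degree 0 shows that the maximum is taken over a nonempty set and, through [PQ],
   that the minimum is too. *)
have P0 : P 0.
  have [a a0] := minimal_fdeg0 F D0; exists 0; split.
    by rewrite ltz_nat (leq_trans _ hr).
  by apply/eqP; rewrite cards_eq0; apply/set0Pn; exists a; rewrite inE a0.
have exP : exists i, `[< P i >] by exists 0%N; apply/asboolP.
have ubP i : `[< P i >] -> (i <= n)%N.
  by move=> /asboolP/PQ[l li _]; rewrite (leq_trans _ li) ?leq_addl.
have exQ : exists l, `[< Q l >].
  by have [l _ Ql] := PQ _ P0; exists l; apply/asboolP.
case: (ex_maxnP exP ubP) => m /asboolP Pm mmax.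
case: (ex_minnP exQ) => s /asboolP Qs smin.
exists m, s; split.
- by split=> // i Pi; apply: mmax; apply/asboolP.
- by split=> // l Ql; apply: smin; apply/asboolP.
have [l li /asboolP/smin sl] := PQ _ Pm.
by rewrite leq_subRL ?(leq_trans _ li) ?leq_add2r // (leq_trans sl) ?leq_addr.
Qed.
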